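(* Let $P\subset M_{\mathbb{R}}$ be a full-dimensional lattice polytope with $F(P)\neq\emptyset$, let $\widetilde{P}=C(P)+F(P)$, and let $\widetilde{\Sigma}$ be the normal fan of $\widetilde{P}$. Consider an arbitrary $2$-dimensional cone $\sigma\in\widetilde{\Sigma}$ and denote by $\nu_i,\nu_j\in\widetilde{\Sigma}[1]\subseteq S_F(P)$ its spanning primitive lattice vectors. Then (a) the $(d-2)$-dimensional affine subspace $L^1_\sigma\subset M_{\mathbb{R}}$ defined by the equations $$\langle x,\nu_i\rangle=\mathrm{Min}_P(\nu_i)+1,\qquad \langle x,\nu_j\rangle=\mathrm{Min}_P(\nu_j)+1$$ has nonempty intersection with $F(P)$; (b) the $(d-2)$-dimensional affine subspace $L^0_\sigma\subset M_{\mathbb{R}}$ defined by the equations $$\langle x,\nu_i\rangle=\mathrm{Min}_P(\nu_i),\qquad \langle x,\nu_j\rangle=\mathrm{Min}_P(\nu_j)$$ contains at least one vertex of $P$.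
   Context: $M\cong\mathbb{Z}^d$ is a lattice, $N=\mathrm{Hom}(M,\mathbb{Z})$ its dual, $\langle\cdot,\cdot\rangle$ the natural pairing, extended to $M_{\mathbb{R}}$ and $N_{\mathbb{R}}$. For a compact convex set $\square\subset M_{\mathbb{R}}$ put $\mathrm{Min}_\square(y)=\min_{x\in\square}\langle x,y\rangle$, $y\in N_{\mathbb{R}}$. The Fine interior is $F(P)=\{x\in M_{\mathbb{R}}\mid \langle x,\nu\rangle\ge \mathrm{Min}_P(\nu)+1\ \forall \nu\in N\setminus\{0\}\}$. If $F(P)\ne\emptyset$, the support of the Fine interior is $S_F(P)=\{\nu\in N\setminus\{0\}\mid \mathrm{Min}_{F(P)}(\nu)=\mathrm{Min}_P(\nu)+1\}$ and the canonical hull is $C(P)=\{x\in M_{\mathbb{R}}\mid \langle x,\nu\rangle\ge\mathrm{Min}_P(\nu)\ \forall\nu\in S_F(P)\}$. Normal fans are taken with inward normals: the cone of a face $Q\preceq P$ is $\{y\in N_{\mathbb{R}}\mid \mathrm{Min}_P(y)=\langle x,y\rangle\ \forall x\in Q\}$. For a fan $\Sigma$, $\Sigma[1]\subset N$ is the set of primitive lattice generators of its $1$-dimensional cones.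
   Formalization: The inclusion of all ray generators of the normal fan of C(P)+F(P) in S_F(P) fails for some P (e.g. with d=5), and then (a) fails; the formal theorem instead assumes that the two spanning vectors ν_i, ν_j lie in S_F(P), which (a) itself forces. *)

(* Defs.v *)
From mathcomp Require Import all_boot all_order all_algebra.
From mathcomp Require Import classical_sets reals.

Set Implicit Arguments.
Unset Strict Implicit.
Unset Printing Implicit Defensive.

Import Order.TTheory GRing.Theory Num.Theory.
Local Open Scope classical_set_scope.
Local Open Scope ring_scope.

(* In a basis of M and the dual basis of N, both lattices are 'rV[int]_d, both
   M_R and N_R are 'rV[R]_d, and the natural pairing is the sum of products of
   coordinates. *)

Definition pairing (R : realType) (d : nat) (x y : 'rV[R]_d) : R :=
  \sum_(i < d) x 0 i * y 0 i.

Definition lat (R : realType) (d : nat) (nu : 'rV[int]_d) : 'rV[R]_d :=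
  map_mx intr nu.
Arguments lat R {d} nu.

(* The infimum is a minimum on the nonempty compact sets this is meant for. *)
Definition Min (R : realType) (d : nat) (A : set 'rV[R]_d) (y : 'rV[R]_d) : R :=
  inf [set pairing x y | x in A].

(* The linear span of A has dimension k: a basis of it can be chosen in A. *)
Definition span_dim (R : realType) (d : nat) (A : set 'rV[R]_d) (k : nat) :
    Prop :=
  exists B : 'M[R]_(k, d),
    [/\ row_free B, forall i, A (row i B) & forall x, A x -> (x <= B)%MS].

Definition aff_dim (R : realType) (d : nat) (A : set 'rV[R]_d) (k : nat) :
    Prop :=
  exists2 x0, A x0 & span_dim [set x - x0 | x in A] k.

Definition affine_subspace (R : realType) (d : nat) (A : set 'rV[R]_d)
    (k : nat) : Prop :=
  exists (x0 : 'rV[R]_d) (B : 'M[R]_(k, d)),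
    row_free B /\ A = [set x | (x - x0 <= B)%MS].

Definition lattice_polytope (R : realType) (d : nat) (P : set 'rV[R]_d) :
    Prop :=
  exists s : seq 'rV[int]_d, s != [::] /\
    P = [set x | exists a : 'I_(size s) -> R,
           [/\ forall i, 0 <= a i, \sum_i a i = 1
             & x = \sum_i a i *: lat R (nth 0 s i)]].

(* Nonempty faces only; y = 0 gives A itself. *)
Definition face (R : realType) (d : nat) (A Q : set 'rV[R]_d) : Prop :=
  Q !=set0 /\ exists y, Q = [set x | A x /\ pairing x y = Min A y].

Definition vertex (R : realType) (d : nat) (A : set 'rV[R]_d) (x : 'rV[R]_d) :
    Prop :=
  face A [set x].

Definition normal_cone (R : realType) (d : nat) (A Q : set 'rV[R]_d) :
    set 'rV[R]_d :=
  [set y | forall x, Q x -> Min A y = pairing x y].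

Definition normal_fan (R : realType) (d : nat) (A : set 'rV[R]_d) :
    set (set 'rV[R]_d) :=
  [set normal_cone A Q | Q in face A].

Definition cone1 (R : realType) (d : nat) (y : 'rV[R]_d) : set 'rV[R]_d :=
  [set x | exists2 s : R, 0 <= s & x = s *: y].

Definition cone2 (R : realType) (d : nat) (y z : 'rV[R]_d) : set 'rV[R]_d :=
  [set x | exists s t : R, [/\ 0 <= s, 0 <= t & x = s *: y + t *: z]].

(* This forces nu != 0, since 0 = 0 *+ k for every k. *)
Definition primitive (d : nat) (nu : 'rV[int]_d) : Prop :=
  forall (k : nat) (mu : 'rV[int]_d), nu = mu *+ k -> k = 1%N.

Definition fan_rays (R : realType) (d : nat) (Sigma : set (set 'rV[R]_d)) :
    set 'rV[int]_d :=
  [set nu | primitive nu /\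
     exists tau, [/\ Sigma tau, span_dim tau 1 & tau = cone1 (lat R nu)]].

Definition fine_interior (R : realType) (d : nat) (P : set 'rV[R]_d) :
    set 'rV[R]_d :=
  [set x | forall nu : 'rV[int]_d, nu != 0 ->
             Min P (lat R nu) + 1 <= pairing x (lat R nu)].

Definition fine_support (R : realType) (d : nat) (P : set 'rV[R]_d) :
    set 'rV[int]_d :=
  [set nu | nu != 0 /\
     Min (fine_interior P) (lat R nu) = Min P (lat R nu) + 1].

Definition canonical_hull (R : realType) (d : nat) (P : set 'rV[R]_d) :
    set 'rV[R]_d :=
  [set x | forall nu : 'rV[int]_d, fine_support P nu ->
             Min P (lat R nu) <= pairing x (lat R nu)].

(* Not every ray generator of the normal fan of P_tilde P lies in
   fine_support P.  For d = 5 and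
     P = {x_1, ..., x_5 >= 0, x_4 + x_5 - x_1 - x_2 - x_3 >= -1,
          x_4 + x_5 <= 5},
   the vector y = (0,0,0,1,1) is a ray generator with Min P y = 0 but
   Min (fine_interior P) y = 3.  Membership in fine_support P is therefore a
   genuine condition on ray generators. *)
Definition P_tilde (R : realType) (d : nat) (P : set 'rV[R]_d) :
    set 'rV[R]_d :=
  [set x + y | x in canonical_hull P & y in fine_interior P].

Definition L_sigma (R : realType) (d : nat) (P : set 'rV[R]_d)
    (nui nuj : 'rV[int]_d) (c : R) : set 'rV[R]_d :=
  [set x | pairing x (lat R nui) = Min P (lat R nui) + c /\
           pairing x (lat R nuj) = Min P (lat R nuj) + c].

(* Main.v *)
(** Write a point [q] of the face dual to [sigma] as [c + f] with [c] in [C(P)]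
    and [f] in [F(P)].  Then [c] and [f] minimize both [nui] and [nuj], on
    [C(P)] and [F(P)] respectively, so [f] lies in [L^1_sigma] and [c] in
    [L^0_sigma].  Put [nu := nui + nuj].  If no point of [P] minimized [nui] and
    [nuj] simultaneously, then, all minima over [P] being integers,
    [Min_P nu >= Min_P nui + Min_P nuj + 1 = <f, nu> - 1].  Hence [nu] would lie
    in [S_F(P)] with [<c, nu> < Min_P nu], contradicting [c] in [C(P)]. *)
Require Import Defs.
From mathcomp Require Import all_boot all_order all_algebra.
From mathcomp Require Import lra zify.
From mathcomp Require Import classical_sets reals.

Set Implicit Arguments.
Unset Strict Implicit.

Import Order.TTheory GRing.Theory Num.Theory.
Local Open Scope classical_set_scope.
Local Open Scope ring_scope.

(** * The pairing, attained minima, and integrality on lattice points *)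

Section Pairing.
Variables (R : realType) (d : nat).
Implicit Types (x y z : 'rV[R]_d) (A : set 'rV[R]_d).

Lemma pairingE x y : pairing x y = (x *m y^T) 0 0.
Proof. by rewrite mxE; apply: eq_bigr => i _; rewrite mxE. Qed.

Lemma pairingDl x y z : pairing (x + y) z = pairing x z + pairing y z.
Proof. by rewrite !pairingE mulmxDl mxE. Qed.

Lemma pairingDr x y z : pairing x (y + z) = pairing x y + pairing x z.
Proof. by rewrite !pairingE linearD /= mulmxDr mxE. Qed.

Lemma pairingBl x y z : pairing (x - y) z = pairing x z - pairing y z.
Proof. by rewrite !pairingE mulmxBl !mxE. Qed.

Lemma pairing_suml (I : finType) (a : I -> R) (v : I -> 'rV[R]_d) y :
  pairing (\sum_i a i *: v i) y = \sum_i a i * pairing (v i) y.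
Proof.
rewrite pairingE mulmx_suml summxE; apply: eq_bigr => i _.
by rewrite -scalemxAl mxE pairingE.
Qed.

Lemma Min_eq A x y : A x ->
  (forall z, A z -> pairing x y <= pairing z y) ->
  Min A y = pairing x y.
Proof.
move=> Ax xmin; apply/eqP; rewrite eq_le; apply/andP; split.
  apply: ge_inf; last by exists x.
  by exists (pairing x y) => _ [z Az <-]; exact: xmin.
apply: lb_le_inf; first by exists (pairing x y), x.
by move=> _ [z Az <-]; exact: xmin.
Qed.

(** The [inf] of a set unbounded below is only a default value, so some lower bound [m] has to be
    supplied. *)
Lemma Min_le A x y (m : R) : (forall z, A z -> m <= pairing z y) ->
  A x -> Min A y <= pairing x y.
Proof.
move=> lbA Ax; apply: ge_inf; last by exists x.
by exists m => _ [z Az <-]; exact: lbA.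
Qed.

Lemma latD (mu nu : 'rV[int]_d) : lat R (mu + nu) = lat R mu + lat R nu.
Proof. exact: raddfD. Qed.

(** Integer-valued copy of [pairing]: a strict inequality between its values is a gap of at least
    1. *)
Definition ipairing (mu nu : 'rV[int]_d) : int := \sum_i mu 0 i * nu 0 i.

Lemma ipairingDr (mu nu nu' : 'rV[int]_d) :
  ipairing mu (nu + nu') = ipairing mu nu + ipairing mu nu'.
Proof. by rewrite -big_split; apply: eq_bigr => i _; rewrite mxE mulrDr. Qed.

Lemma ipairingBl (mu mu' nu : 'rV[int]_d) :
  ipairing (mu - mu') nu = ipairing mu nu - ipairing mu' nu.
Proof. by rewrite -sumrB; apply: eq_bigr => i _; rewrite !mxE mulrBl. Qed.

Lemma pairing_lat (mu nu : 'rV[int]_d) :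
  pairing (lat R mu) (lat R nu) = (ipairing mu nu)%:~R.
Proof.
by rewrite /pairing rmorph_sum; apply: eq_bigr => i _; rewrite !mxE rmorphM.
Qed.

Lemma ipairing_gt0 (mu : 'rV[int]_d) : mu != 0 -> 0 < ipairing mu mu.
Proof.
move=> mu0; have nneg i : true -> 0 <= mu 0 i * mu 0 i by rewrite -expr2 sqr_ge0.
rewrite lt0r sumr_ge0 // andbT psumr_eq0 //; apply: contra mu0 => /allP mu0.
apply/eqP/rowP => i; have := mu0 i (mem_index_enum _).
by rewrite mulf_eq0 orbb mxE => /eqP.
Qed.

Lemma ipairingC (mu nu : 'rV[int]_d) : ipairing mu nu = ipairing nu mu.
Proof. by apply: eq_bigr => i _; rewrite mulrC. Qed.

Lemma ipairingBr (mu nu nu' : 'rV[int]_d) :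
  ipairing mu (nu - nu') = ipairing mu nu - ipairing mu nu'.
Proof. by rewrite ipairingC ipairingBl !(ipairingC mu). Qed.

Lemma ipairingMnr (mu nu : 'rV[int]_d) (k : nat) :
  ipairing mu (nu *+ k) = ipairing mu nu *+ k.
Proof. by rewrite -sumrMnl; apply: eq_bigr => i _; rewrite mulmxnE mulrnAr. Qed.

End Pairing.

(** * Vertices of lattice polytopes *)

Lemma seq_argmin {T : eqType} (f : T -> int) (s : seq T) : s != [::] ->
  exists2 x, x \in s & forall y, y \in s -> f x <= f y.
Proof.
elim: s => // a s IHs _; have [->|/IHs[x xs xmin]] := eqVneq s [::].
  by exists a; rewrite ?mem_head // => y; rewrite inE => /eqP ->.
have [le_ax|lt_xa] := leP (f a) (f x).
  exists a; rewrite ?mem_head // => y; rewrite inE => /predU1P[->//|/xmin].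
  exact: le_trans.
exists x; rewrite ?inE ?xs ?orbT // => y /predU1P[->|/xmin //].
exact: ltW.
Qed.

Section Hull.
Variables (R : realType) (d : nat) (s : seq 'rV[int]_d).

(** Same set as in [lattice_polytope], so that the lemmas below apply to [P] by conversion. *)
Definition lattice_hull : set 'rV[R]_d :=
  [set x | exists a : 'I_(size s) -> R,
     [/\ forall i, 0 <= a i, \sum_i a i = 1
       & x = \sum_i a i *: lat R (nth 0 s i)]].

Lemma lattice_hull_mem mu : mu \in s -> lattice_hull (lat R mu).
Proof.
move=> mus; have lt_i : (index mu s < size s)%N by rewrite index_mem.
exists (fun i => (i == Ordinal lt_i)%:R); split=> [i||].
- by rewrite ler0n.
- by rewrite (bigD1 (Ordinal lt_i)) //= eqxx big1 ?addr0 // => i /negbTE ->.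
- rewrite (bigD1 (Ordinal lt_i)) //= eqxx big1 ?addr0 ?scale1r ?nth_index //.
  by move=> i /negbTE ->; rewrite scale0r.
Qed.

Lemma lattice_hull_ge (y : 'rV[R]_d) (m : R) :
  (forall mu, mu \in s -> m <= pairing (lat R mu) y) ->
  forall x, lattice_hull x -> m <= pairing x y.
Proof.
move=> lbs _ [a [a0 a1 ->]]; rewrite pairing_suml -[m]mul1r -a1 mulr_suml.
by apply: ler_sum => i _; rewrite ler_wpM2l // lbs // mem_nth.
Qed.

(** If a convex combination attains the minimum, its excess is a vanishing sum of nonnegative terms,
    so strictness kills every weight off [mu0]. The list [s] may contain [mu0] several times. *)
Lemma lattice_hull_vertex (nu mu0 : 'rV[int]_d) : mu0 \in s ->
  (forall mu, mu \in s -> mu != mu0 -> ipairing mu0 nu < ipairing mu nu) ->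
  vertex lattice_hull (lat R mu0).
Proof.
move=> mu0s mu0min; have hull0 := lattice_hull_mem mu0s.
have mu0le mu : mu \in s ->
    pairing (lat R mu0) (lat R nu) <= pairing (lat R mu) (lat R nu).
  move=> mus; rewrite !pairing_lat ler_int; have [->//|neq] := eqVneq mu mu0.
  exact: ltW (mu0min _ mus neq).
have MinE := Min_eq hull0 (lattice_hull_ge mu0le).
split; first by exists (lat R mu0).
exists (lat R nu); rewrite MinE; apply/seteqP; split=> [_ ->//|x []].
move=> [a [a0 a1 ->]] /eqP.
rewrite pairing_suml -[X in _ == X]mul1r -a1 mulr_suml -subr_eq0.
rewrite -sumrB psumr_eq0 => [/allP eq0|i _]; last first.
  by rewrite -mulrBr mulr_ge0 // subr_ge0 mu0le // mem_nth.
transitivity (\sum_i a i *: lat R mu0); last by rewrite -scaler_suml a1 scale1r.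
apply: eq_bigr => i _; have [->//|neq] := eqVneq (nth 0 s i) mu0.
have := eq0 i (mem_index_enum _); rewrite -mulrBr mulf_eq0 !pairing_lat.
rewrite -intrB intr_eq0 subr_eq0 (gt_eqF (mu0min _ (mem_nth 0 _) neq)) // orbF.
by move=> /eqP ->; rewrite !scale0r.
Qed.

(* Among the generators minimizing [nu], one of maximal Euclidean norm is a
   vertex, exposed by [T * nu - mu0] for large [T]. *)
Lemma lattice_hull_vertex_min (nu : 'rV[int]_d) : s != [::] ->
  exists mu0, [/\ mu0 \in s, vertex lattice_hull (lat R mu0)
    & forall mu, mu \in s -> ipairing mu0 nu <= ipairing mu nu].
Proof.
move=> s0; have [mu1 mu1s mu1min] := seq_argmin (fun mu => ipairing mu nu) s0.
pose G := [seq mu <- s | ipairing mu nu == ipairing mu1 nu].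
have G0 : G != [::].
  apply/eqP => G0; have := in_nil mu1.
  by rewrite -G0 mem_filter eqxx mu1s.
have [mu0] := seq_argmin (fun mu => - ipairing mu mu) G0.
rewrite mem_filter => /andP[/eqP mu0nu mu0s] mu0max.
exists mu0; split=> // [|mu mus]; last by rewrite mu0nu mu1min.
(* [g mu] bounds what the perturbation by [- mu0] can cost; the factor [T] is one more than its
   maximum. *)
pose g mu := `|ipairing (mu - mu0) mu0|%N.
apply: (lattice_hull_vertex (nu := nu *+ (\max_(mu <- s) g mu).+1 - mu0)) => //.
move=> mu mus neq.
rewrite -subr_gt0 -ipairingBl ipairingBr ipairingMnr subr_gt0 (ipairingBl _ _ nu).
have [eqnu|neqnu] := eqVneq (ipairing mu nu) (ipairing mu1 nu).
  (* On a tie, [ipairing (mu - mu0) mu0 < 0] follows from the positive square norm of [mu - mu0] and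
     the maximal norm of [mu0]. *)
  rewrite eqnu mu0nu subrr mul0rn.
  have : mu \in G by rewrite mem_filter eqnu eqxx.
  move=> /mu0max; have := ipairing_gt0 (mu := mu - mu0).
  rewrite subr_eq0 => /(_ neq).
  rewrite !ipairingBl !ipairingBr (ipairingC mu0 mu); lra.
(* Without a tie, integrality makes the gap at least 1, so [T] times the gap exceeds [g mu]. *)
have gap : 1 <= ipairing mu nu - ipairing mu0 nu.
  by rewrite lerBrDl lezD1 lt_neqAle eq_sym mu0nu neqnu mu1min.
apply: lt_le_trans (_ : (\max_(nu0 <- s) g nu0).+1%:Z <= _); last first.
  by rewrite -[X in X <= _]mul1r -[leRHS]mulr_natr natz ler_wpM2r.
apply: le_lt_trans (ler_norm _) _; rewrite -abszE ltz_nat ltnS.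
exact: leq_bigmax_seq.
Qed.

End Hull.

(** * Ranks and dimensions *)

Section Dimension.
Variables (R : realType) (d : nat).
Implicit Types y z : 'rV[R]_d.

(** The two independent vectors given by [span_dim] are combinations of [y] and [z], which forces
    rank 2. *)
Lemma span_dim_cone2 y z : span_dim (cone2 y z) 2 -> row_free (col_mx y z).
Proof.
move=> [B [freeB rowB _]].
have subB : (B <= col_mx y z)%MS.
  apply/row_subP => i; have [a [b [_ _ ->]]] := rowB i.
  by rewrite -addsmxE addmx_sub_adds // scalemx_sub.
rewrite /row_free eqn_leq rank_leq_row (leq_trans _ (mxrankS subB)) //.
by move: freeB; rewrite /row_free => /eqP ->.
Qed.

(** A zero sum would be a linear relation with coefficients (1, 1). *)
Lemma row_free_add_neq0 y z : row_free (col_mx y z) -> y + z != 0.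
Proof.
move=> freeyz; apply/eqP => yz0.
have /(row_free_inj freeyz)/matrixP/(_ 0 0)/eqP :
    row_mx (1%:M : 'M_1) (1%:M : 'M_1) *m col_mx y z = 0 *m col_mx y z.
  by rewrite mul_row_col !mul1mx mul0mx.
by rewrite !mxE; case: splitP => j _; rewrite !mxE ?ord1 eqxx oner_eq0.
Qed.

(** The direction space is the kernel of the matrix with columns [y] and [z]. Independence forces
    [d >= 2], so the subtraction is not truncated. *)
Lemma affine_subspace_level2 y z x0 : row_free (col_mx y z) ->
  affine_subspace [set x | pairing x y = pairing x0 y /\
                           pairing x z = pairing x0 z] (d - 2).
Proof.
move=> freeyz; pose K := kermx (row_mx y^T z^T).
have <- : \rank K = (d - 2)%N.
  rewrite mxrank_ker -tr_col_mx mxrank_tr.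
  by move: freeyz; rewrite /row_free => /eqP ->.
exists x0, (row_base K); split; first exact: row_base_free.
apply/seteqP; split=> x /=; rewrite eq_row_base.
  move=> [xy xz]; apply/sub_kermxP; rewrite mul_mx_row.
  suff [-> ->] : (x - x0) *m y^T = 0 /\ (x - x0) *m z^T = 0 by exact: row_mx0.
  split; apply/matrixP => i j; rewrite !ord1 -pairingE pairingBl mxE.
    by rewrite xy subrr.
  by rewrite xz subrr.
move/sub_kermxP; rewrite mul_mx_row -row_mx0 => /eq_row_mx [xy xz].
split; apply/eqP; rewrite -subr_eq0 -pairingBl pairingE.
  by rewrite xy mxE.
by rewrite xz mxE.
Qed.

End Dimension.

(** * Points of the face dual to [sigma], and the test vector [nui + nuj] *)

Theorem theorem6p7 (R : realType) (d : nat) (P : set 'rV[R]_d)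
    (hP : lattice_polytope P) (hdim : aff_dim P d)
    (hF : fine_interior P !=set0)
    (sigma : set 'rV[R]_d)
    (hsigma : normal_fan (P_tilde P) sigma) (hsigma2 : span_dim sigma 2)
    (nui nuj : 'rV[int]_d)
    (hi : fan_rays (normal_fan (P_tilde P)) nui)
    (hj : fan_rays (normal_fan (P_tilde P)) nuj)
    (hiS : fine_support P nui) (hjS : fine_support P nuj)
    (hspan : sigma = cone2 (lat R nui) (lat R nuj)) :
  (affine_subspace (L_sigma P nui nuj 1) (d - 2) /\
   L_sigma P nui nuj 1 `&` fine_interior P !=set0) /\
  (affine_subspace (L_sigma P nui nuj 0) (d - 2) /\
   exists2 x, vertex P x & L_sigma P nui nuj 0 x).
Proof.
have [s [s0 defP]] := hP.
have Pmem mu : mu \in s -> P (lat R mu).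
  by rewrite defP; exact: lattice_hull_mem.
(* The minimum is expressed by [ipairing] because the last step needs its integrality as well as a
   vertex attaining it. *)
have Pvertex nu : exists mu, [/\ mu \in s, vertex P (lat R mu),
    Min P (lat R nu) = (ipairing mu nu)%:~R
    & forall x, P x -> Min P (lat R nu) <= pairing x (lat R nu)].
  have [mu [mus vmu mumin]] := lattice_hull_vertex_min R nu s0.
  have mule x : P x -> pairing (lat R mu) (lat R nu) <= pairing x (lat R nu).
    rewrite defP; apply: lattice_hull_ge => mu' mu's.
    by rewrite !pairing_lat ler_int mumin.
  have MinE := Min_eq (Pmem _ mus) mule.
  exists mu; split=> //; first by rewrite defP.
    by rewrite MinE pairing_lat.
  by rewrite MinE.
have Pge nu x : P x -> Min P (lat R nu) <= pairing x (lat R nu).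
  by have [mu [_ _ _]] := Pvertex nu; exact.
have PC x : P x -> canonical_hull P x by move=> Px nu _; exact: Pge.
have freeij : row_free (col_mx (lat R nui) (lat R nuj)).
  by apply: span_dim_cone2; rewrite -hspan.
have [Q [[q Qq] [y defQ]] defsigma] := hsigma.
have [c Cc [f Ff defq]] : P_tilde P q by move: Qq; rewrite defQ => -[].
have cf_min nu : fine_support P nu -> sigma (lat R nu) ->
    pairing c (lat R nu) = Min P (lat R nu) /\
    pairing f (lat R nu) = Min P (lat R nu) + 1.
  move=> nuS; rewrite -defsigma => /(_ q Qq); rewrite -defq pairingDl => Mincf.
  have [nu0 MinF] := nuS.
  have tilde_ge x : P_tilde P x -> Min P (lat R nu) + (Min P (lat R nu) + 1)
      <= pairing x (lat R nu).
    by move=> [c' Cc' [f' Ff' <-]]; rewrite pairingDl lerD ?Cc' ?Ff'.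
  (* Taking [f' = f] or [c' = c] below separates the two minimizations. *)
  have cf_le c' f' : canonical_hull P c' -> fine_interior P f' ->
      pairing c (lat R nu) + pairing f (lat R nu)
      <= pairing c' (lat R nu) + pairing f' (lat R nu).
    move=> Cc' Ff'; rewrite -Mincf -pairingDl.
    by apply: Min_le tilde_ge _; exists c' => //; exists f'.
  split.
    (* The upper bound comes from comparing [c] with a vertex of [P] minimizing [nu], which lies in
       C(P). *)
    apply/eqP; rewrite eq_le Cc // andbT.
    have [mu [mus _ -> _]] := Pvertex nu; rewrite -pairing_lat.
    by rewrite -(lerD2r (pairing f (lat R nu))) cf_le //; exact/PC/Pmem.
  rewrite -MinF; apply/esym/Min_eq => // f' Ff'.
  by rewrite -(lerD2l (pairing c (lat R nu))) cf_le.
have [ci fi] : pairing c (lat R nui) = Min P (lat R nui) /\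
    pairing f (lat R nui) = Min P (lat R nui) + 1.
  apply: cf_min => //; rewrite hspan; exists 1, 0.
  by rewrite ler01 lexx scale1r scale0r addr0.
have [cj fj] : pairing c (lat R nuj) = Min P (lat R nuj) /\
    pairing f (lat R nuj) = Min P (lat R nuj) + 1.
  apply: cf_min => //; rewrite hspan; exists 0, 1.
  by rewrite ler01 lexx scale1r scale0r add0r.
split; split.
(* The point [f] serves as base point here, and [c] does so for the level 0. *)
- by rewrite /L_sigma -fi -fj; exact: affine_subspace_level2.
- by exists f.
- by rewrite /L_sigma !addr0 -ci -cj; exact: affine_subspace_level2.
have [mu [mus vmu Minmu _]] := Pvertex (nui + nuj).
exists (lat R mu) => //; rewrite /L_sigma /= !addr0.
have := Pge nui _ (Pmem _ mus); have := Pge nuj _ (Pmem _ mus).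
have [[mi [_ _ Mini _]] [mj [_ _ Minj _]]] := (Pvertex nui, Pvertex nuj).
have nu0 : nui + nuj != 0.
  apply: contraNneq (row_free_add_neq0 freeij) => nu0.
  by rewrite -latD nu0 /lat map_mx0.
move: (Ff _ nu0); rewrite {2}latD pairingDr fi fj Mini Minj Minmu !pairing_lat.
rewrite !ler_int => nule jle ile.
(* A gap of at least 1 makes [f] attain the bound for [nui + nuj], which puts this vector in the
   support; then [c] violates its inequality. *)
have [gap|] := ltP (ipairing mi nui + ipairing mj nuj) (ipairing mu (nui + nuj)).
  have Minf : Min P (lat R (nui + nuj)) + 1 = pairing f (lat R (nui + nuj)).
    apply/eqP; rewrite eq_le Ff //= latD pairingDr fi fj -latD Mini Minj Minmu.
    move: gap; rewrite -lezD1 -(ler_int R) !rmorphD /=; lra.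
  have nuS : fine_support P (nui + nuj).
    by split=> //; rewrite Minf; apply: Min_eq => // f' Ff'; rewrite -Minf Ff'.
  have := Cc _ nuS; rewrite {2}latD pairingDr ci cj Mini Minj Minmu -intrD ler_int.
  by rewrite leNgt gap.
(* Each summand is at least its own minimum and the sum is at most the sum of the minima, so both
   are equalities. *)
by rewrite ipairingDr => sumle; split; congr (_%:~R); lia.
Qed.
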